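(* For every integer $n\ge 5$, the graph $\mathrm{KG}(\mathcal{T}_n)$ (the Kneser graph of triangulations of a convex $n$-gon) has a Hamiltonian cycle.
   Context: Fix a convex $n$-gon with vertex set $[n]=\{1,\dots,n\}$ in cyclic order. Its diagonals are $\mathrm{Diag}(n)=\{\{i,j\}\in\binom{[n]}{2} : i-j\not\equiv \pm1 \pmod n\}$. Two diagonals cross if they intersect in an interior point of both. A triangulation of the polygon is identified with its set of $n-3$ pairwise noncrossing diagonals, and $\mathcal{T}_n$ is the set of all triangulations. The Kneser graph $\mathrm{KG}(\mathcal{T}_n)$ has vertex set $\mathcal{T}_n$, and two triangulations are adjacent if and only if they share no diagonal, i.e. they are disjoint as sets of diagonals. *)

(* Defs.v *)
From mathcomp Require Import all_boot all_order all_algebra.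

Set Implicit Arguments.
Unset Strict Implicit.
Unset Printing Implicit Defensive.

Import Order.TTheory GRing.Theory Num.Theory.
Local Open Scope ring_scope.

Section Geometry.

Variables (R : realFieldType) (n : nat).

(* Twice the signed area of the triangle abc: its sign tells on which side of
   the line ab the point c lies. *)
Definition orient (a b c : 'rV[R]_2) : R :=
  (b 0 0 - a 0 0) * (c 0 1 - a 0 1) - (b 0 1 - a 0 1) * (c 0 0 - a 0 0).

(* For every edge, the remaining vertices lie strictly on one side of the line
   spanned by it. ordS is the cyclic successor, and the vertices may be listed
   clockwise or counterclockwise. *)
Definition convex_polygon (p : 'I_n -> 'rV[R]_2) : Prop :=
  forall i k l : 'I_n,
    k \notin [set i; ordS i] -> l \notin [set i; ordS i] ->
    0 < orient (p i) (p (ordS i)) (p k) * orient (p i) (p (ordS i)) (p l).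

(* i and j range over both orders, so this excludes i - j = 1 and i - j = -1
   modulo n. *)
Definition is_diagonal (d : {set 'I_n}) : bool :=
  (#|d| == 2) && [forall i in d, forall j in d, i != j.+1 %[mod n]].

Definition diagonal_interior (p : 'I_n -> 'rV[R]_2) (d : {set 'I_n})
    (x : 'rV[R]_2) : Prop :=
  exists (i j : 'I_n) (t : R),
    [/\ d = [set i; j], 0 < t < 1 & x = (1 - t) *: p i + t *: p j].

Definition cross (p : 'I_n -> 'rV[R]_2) (d e : {set 'I_n}) : Prop :=
  exists x, diagonal_interior p d x /\ diagonal_interior p e x.

Definition is_triangulation (p : 'I_n -> 'rV[R]_2) (T : {set {set 'I_n}}) :
    Prop :=
  [/\ {in T, forall d, is_diagonal d},
      #|T| = (n - 3)%N
    & {in T &, forall d e, d != e -> ~ cross p d e}].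

End Geometry.

(* Adjacency in a Kneser graph; the vertex set, a family of sets, is given
   separately. *)
Definition kneser_adj (T : finType) : rel {set T} :=
  fun A B => [disjoint A & B].

(* A Hamiltonian cycle of the graph with vertices the v such that P v, and
   adjacency e. *)
Definition hamiltonian_cycle (V : eqType) (P : V -> Prop) (e : rel V)
    (c : seq V) : Prop :=
  [/\ (2 < size c)%N, forall v, v \in c <-> P v & ucycle e c].

(* Main.v *)
Require Import Defs.
From mathcomp Require Import all_boot all_order all_algebra.
From mathcomp Require Import zify ring lra.

Set Implicit Arguments.
Unset Strict Implicit.
Unset Printing Implicit Defensive.

(**
Rotating a diagonal by one vertex gives a diagonal that crosses it
([rotd_crosses]), so a triangulation T is always disjoint from its rotation rT.
The orbits of the rotation r therefore cover the Kneser graph by disjoint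
cycles, and these have to be merged into one.

Two such cycles can be merged whenever a triangulation w of the first is
disjoint from some z of the second: then rw and rz are disjoint too, and
deleting the edges w -- rw and z -- rz in favour of w -- z and rw -- rz leaves
a single cycle.  Flips provide these disjoint pairs: if T' arises from T by
flipping one diagonal, then T is disjoint from rT' or rT is disjoint from T'
([flips_link]), because a common diagonal in both cases would force two
successive rotations to fix a diagonal, which is impossible for n >= 5.
As the flip graph is connected ([flips_connected]), all orbits can be reached
in this way by merging one orbit at a time.

An orbit of size m has only m edges to give away, and each merge uses up one of
them, so there must be enough edges: the flips of T must lead to at most m
different orbits ([flips_few]).  This is clear when m = n, since T has n - 3
diagonals.  In general the stabiliser of T has order n / m and permutes the
diagonals of T; diagonals in the same class flip to triangulations in the same
orbit, and a class has n / m elements unless it contains a diameter of the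
polygon, of which T has at most one.

The merging argument is carried out for an arbitrary automorphism of a finite
graph in [hamiltonian_of_orbits].  The combinatorics of triangulations rests on
the bound n - 3 for noncrossing families ([noncrossing_card]), which makes
triangulations maximal and puts every diagonal between two triangles ([apex]).
The link with the geometric definition is that all triples of vertices of a
convex polygon taken in cyclic order turn the same way ([turn_cyc]), so that
segments meet exactly when their endpoints interleave ([cross_crosses]).
*)

(** * Gluing the orbits of an automorphism into a Hamiltonian cycle *)

Lemma next_consE (V : eqType) (x : V) (s : seq V) (w : V) :
  w \in x :: s -> next (x :: s) w = nth x s (index w (x :: s)).
Proof. by move=> ws; rewrite next_nth ws. Qed.

Lemma index_notlast (V : eqType) (x : V) (s : seq V) (w : V) :
  w \in x :: s -> w != last x s -> index w (x :: s) < size s.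
Proof.
move=> ws wl; have := ws; rewrite -index_mem ltnS leq_eqVlt => /orP[/eqP E|//].
by case/eqP: wl; rewrite (last_nth x) -(nth_index x ws) E.
Qed.

(** Replacing the edge of a cycle [c] that leaves [u] by a path [q] through new
    vertices; the successor maps are controlled so that one can tell which other
    edges survive. *)
Lemma cycle_insert (V : eqType) (e : rel V) (c q : seq V) (u : V) :
  ucycle e c -> u \in c -> uniq q -> ~~ has (mem c) q ->
  path e u q -> e (last u q) (next c u) ->
  exists c', [/\ ucycle e c', c' =i c ++ q,
    {in c, forall w, w != u -> next c' w = next c w}
    & {in q, forall w, w != last u q -> next c' w = next q w}].
Proof.
move=> /andP[ec Uc] uc Uq qc eq elast.
have vc : next c u \in c by rewrite mem_next.
have [i s ds] := rot_to vc; set v := next c u in ds elast vc.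
have Us : uniq (v :: s) by rewrite -ds rot_uniq.
have es : cycle e (v :: s) by rewrite -ds rot_cycle.
have nx w : next (v :: s) w = next c w by rewrite -ds next_rot.
(* [c] is rotated so that the edge to be cut joins its end to its beginning. *)
have us : last v s = u.
  apply: (can_inj (prev_next Us)); rewrite [RHS]nx -/v next_nth mem_last.
  by rewrite index_last // nth_default.
have mc : v :: s =i c by move=> w; rewrite -ds mem_rot.
have Uvsq : uniq (v :: s ++ q).
  rewrite -cat_cons cat_uniq Us Uq andbT /=.
  by rewrite (eq_has (a2 := mem c)) // => w; rewrite /= mc.
exists (v :: s ++ q); split.
- rewrite /ucycle Uvsq andbT /= rcons_cat cat_path.
  move: es; rewrite /= !rcons_path us eq elast => /andP[-> _] //=.
- by move=> w; rewrite -cat_cons !mem_cat mc.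
- move=> w wc wu; rewrite -mc in wc; rewrite -nx -cat_cons.
  rewrite [LHS]next_consE -?cat_cons ?mem_cat ?wc // index_cat wc.
  by rewrite nth_cat index_notlast ?us // -next_consE.
case: q Uq qc eq elast Uvsq => // a q Uq qc eq elast Uvsq w wq wl.
have wc : w \in v :: s = false.
  by apply/negbTE; rewrite mc; apply: contra qc => wc; apply/hasP; exists w.
rewrite [RHS]next_consE // [LHS]next_consE -?cat_cons ?mem_cat ?wq ?orbT //.
rewrite index_cat wc nth_cat ltnNge [size (v :: s)]/= ltnW ?ltnS ?leq_addr //=.
rewrite addSn -addnS addKn /=.
exact/set_nth_default/index_notlast.
Qed.

(** [e] is the adjacency of a graph on [P], [r] an automorphism that moves each
    vertex to a neighbour, and [g] an auxiliary [r]-invariant relation that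
    connects [P] and whose pairs lie in orbits joined by an edge of the graph. *)
Section Gluing.

Variables (V : finType) (P : pred V) (e g : rel V) (r : V -> V).

Hypothesis e_sym : symmetric e.
Hypothesis r_inj : injective r.
Hypothesis e_r : forall x, P x -> e x (r x).
Hypothesis e_rr : forall x y, e x y -> e (r x) (r y).
Hypothesis P_r : forall x, P x -> P (r x).
Hypothesis g_sym : symmetric g.
Hypothesis g_rr : forall x y, g x y -> g (r x) (r y).
Hypothesis g_P : forall x y, g x y -> P y.
Hypothesis g_conn : forall x y, P x -> P y -> connect g x y.
Hypothesis g_link : forall x y, g x y -> e x (r y) || e (r x) y.
Hypothesis g_few :
  forall x, P x -> #|[set froot r y | y in g x]| <= order r x.

Let r_sym := fconnect_sym r_inj.

(** The edge w -- rw of an orbit may be traversed by a tour in either direction;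
    [b w] says that it is traversed from rw to w.  Fixing the direction beforehand
    matters for orbits of size 2, where w -- rw and rw -- rrw are two parallel
    edges that would otherwise be confused. *)
Definition edge_src (b : V -> bool) w := if b w then r w else w.
Definition edge_tgt (b : V -> bool) w := if b w then w else r w.
Definition kept_edge (c : seq V) (b : V -> bool) (w : V) : bool :=
  next c (edge_src b w) == edge_tgt b w.

(** A cycle through a union of orbits, obtained by merging.  The invariant
    [tour_cap] charges every edge that the orbit of [x] has lost to a different
    orbit that is a [g]-neighbour of it and already visited. *)
Record partial_tour (c : seq V) (b : V -> bool) : Prop := PartialTour {
  tour_cycle : ucycle e c;
  tour_P : {subset c <= P};
  tour_r : forall x, x \in c -> r x \in c;
  tour_dir : forall x, b (r x) = b x;
  tour_cap : forall x, x \in c ->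
    #|[set w in fconnect r x | ~~ kept_edge c b w]|
      <= #|[set froot r y | y in [pred y | g x y && (y \in c)]]|
}.

Lemma froot_eq x y : (froot r x == froot r y) = fconnect r x y.
Proof. exact: root_connect. Qed.

Lemma orbit_transport (h : rel V) x w y :
  (forall x y, h x y -> h (r x) (r y)) -> h x y -> fconnect r x w ->
  exists2 z, fconnect r y z & h w z.
Proof.
move=> h_rr hxy /iter_findex <-; exists (iter (findex r x w) r y).
  exact: fconnect_iter.
by elim: (findex r x w) => //= k; apply: h_rr.
Qed.

(** As [r] is an automorphism, one edge between two orbits yields an edge from
    every vertex of the first one to the second one. *)
Lemma link_orbit x w y : g x y -> fconnect r x w ->
  exists2 z, fconnect r y z & e w z.
Proof.
move=> /g_link /orP[] exy xw.
  have [z yz ez] := orbit_transport e_rr exy xw; exists z => //.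
  by rewrite (same_fconnect1 r_inj).
by rewrite (same_fconnect1 r_inj) in xw; apply: orbit_transport e_rr exy xw.
Qed.

Lemma tour_orbit c b x y : partial_tour c b -> fconnect r x y ->
  (x \in c) = (y \in c).
Proof.
move=> t; have cl : fclosed r (mem c).
  apply: intro_closed => [|u v /eqP <- /(tour_r t)//]; exact: r_sym.
exact: closed_connect.
Qed.

Lemma dir_orbit (c : seq V) b x y : partial_tour c b -> fconnect r x y -> b x = b y.
Proof.
move=> t /iter_findex <-; elim: (findex _ _ _) => //= k ->.
by rewrite (tour_dir t).
Qed.

Lemma tour_start x : P x -> partial_tour (orbit r x) xpred0.
Proof.
move=> Px.
have Po y : y \in orbit r x -> P y.
  by rewrite -fconnect_orbit => /iter_findex <-; elim: (findex _ _ _) => //= k /P_r.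
have cyc := cycle_orbit r_inj x.
split=> //.
- rewrite /ucycle orbit_uniq andbT.
  apply: (sub_in_cycle (P := [pred y in orbit r x]) _ _ cyc); last by apply/allP.
  by move=> u v /= /Po Pu _ /eqP <-; apply: e_r.
- by move=> y; rewrite -!fconnect_orbit -same_fconnect1_r.
move=> y yo; rewrite [X in #|pred_of_set X|](_ : _ = set0) ?cards0 //.
apply/setP => w; rewrite !inE /kept_edge /=; apply/negbTE; rewrite negb_and negbK.
case: (boolP (fconnect r y w)) => //= yw; rewrite /edge_src /edge_tgt /=; apply/eqP/(nextE cyc).
by move: yo; rewrite -!fconnect_orbit => /connect_trans; apply.
Qed.

(** The unvisited orbit of [y] is a neighbour of the orbit of [x] that has not
    been charged, so by [g_few] the latter still owns an edge w -- rw.  It is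
    replaced by w -- z, the whole orbit of z, and rz -- rw, which costs one edge of
    each of the two orbits, charged to the other one. *)
Lemma tour_grow c b x y : partial_tour c b -> x \in c -> g x y -> y \notin c ->
  exists c' b', partial_tour c' b' /\ size c < size c'.
Proof.
move=> t xc gxy yc.
have Py := g_P gxy.
have [w xw kw] : exists2 w, fconnect r x w & kept_edge c b w.
  case: (pickP [pred w | fconnect r x w && kept_edge c b w]) => [w /andP[]|nk].
    by exists w.
  have := g_few (tour_P t xc); rewrite leqNgt => /negP[].
  have {1}-> : order r x = #|[set w in fconnect r x | ~~ kept_edge c b w]|.
    apply: eq_card => w; rewrite !inE.
    by have /= := nk w; case: (fconnect r x w) => //= ->.
  apply: leq_ltn_trans (tour_cap t xc) _; apply: proper_card.
  apply/properP; split.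
    by apply: imsetS; apply/subsetP => z /andP[].
  exists (froot r y); first exact: imset_f.
  apply: contra yc => /imsetP[z /andP[_ zc] /eqP].
  by rewrite froot_eq => /(tour_orbit t) ->.
have [z yz ewz] := link_orbit gxy xw.
have wc : w \in c by rewrite -(tour_orbit t xw).
have zc : z \notin c by rewrite -(tour_orbit t yz).
have iterP k v : P v -> P (iter k r v) by elim: k => //= k IH /IH/P_r.
have Pz : P z by rewrite -(iter_findex yz) iterP.
set o := orbit r (r z).
have oE v : v \in o = fconnect r z v.
  by rewrite -fconnect_orbit -(same_fconnect1 r_inj).
have cyco : fcycle r o := cycle_orbit r_inj _.
have Uo : uniq o := orbit_uniq _ _.
have oP v : v \in o -> P v.
  by rewrite oE => /iter_findex <-; apply: iterP.
have ecyco : cycle e o.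
  apply: (sub_in_cycle (P := [pred y in o]) _ _ cyco); last by apply/allP.
  by move=> u v /= /oP Pu _ /eqP <-; apply: e_r.
have [s [os lasts]] : exists s, o = r z :: s /\ last (r z) s = z.
  exists (traject r (r (r z)) (order r (r z)).-1).
  rewrite /o /orbit -orderSpred; split=> //.
  by rewrite last_traject; apply: r_inj; rewrite -iterS orderSpred iter_order.
(* The detour runs from z back to rz if the edge is traversed from w to rw, and
   from rz on to z otherwise: the new orbit gets the opposite direction. *)
pose b' v := if fconnect r z v then ~~ b w else b v.
have b'o v : v \in o -> b' v = ~~ b w by rewrite oE /b' => ->.
have [q [qo Uq eq elast nextq]] : exists q, [/\ q =i o, uniq q,
    path e (edge_src b w) q, e (last (edge_src b w) q) (edge_tgt b w)
  & forall v, v \in o -> v != z ->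
      edge_src b' v != last (edge_src b w) q /\ next q (edge_src b' v) = edge_tgt b' v].
  case bw: (b w).
    exists o; rewrite /edge_src /edge_tgt bw; split=> //.
    - by move: ecyco; rewrite os /= e_rr // rcons_path => /andP[].
    - by rewrite os /= lasts e_sym.
    move=> v vo vz; have -> : last (r w) o = z by rewrite os.
    rewrite b'o // bw; split=> //; exact: (nextE cyco).
  exists (rev o); rewrite /edge_src /edge_tgt bw; split.
  - by move=> v; rewrite mem_rev.
  - by rewrite rev_uniq.
  - have : cycle e (rev o).
      by rewrite rev_cycle (eq_cycle (e' := e)) // => u v; rewrite e_sym.
    have [s' ->] : exists s', rev o = z :: s'.
      by rewrite os lastI lasts rev_rcons; eexists.
    by rewrite /= rcons_path ewz => /andP[].
  - by rewrite os rev_cons last_rcons e_sym e_rr.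
  move=> v vo vz; have -> : last w (rev o) = r z by rewrite os rev_cons last_rcons.
  rewrite b'o // bw (inj_eq r_inj); split=> //=.
  by rewrite next_rev // -(nextE cyco vo) prev_next.
have disj : ~~ has (mem c) q.
  by apply/hasPn => v; rewrite qo oE /= => zv; rewrite -(tour_orbit t zv).
have srco b0 v : fconnect r v (edge_src b0 v).
  by rewrite /edge_src; case: ifP => // _; apply: fconnect1.
have elast' : e (last (edge_src b w) q) (next c (edge_src b w)) by rewrite (eqP kw).
have srcc v : (edge_src b v \in c) = (v \in c) by rewrite (tour_orbit t (srco b v)).
have [|c' [cyc' c'E nextc nexto]] :=
  cycle_insert (tour_cycle t) _ Uq disj eq elast'; first by rewrite srcc.
have b'c v : v \in c -> b' v = b v.
  by rewrite /b'; case: ifP => // zv; rewrite -(tour_orbit t zv) (negbTE zc).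
(* Only the edge of [w] is lost in the tour, and only that of [z] in its orbit. *)
have keepc v : v \in c -> v != w -> kept_edge c b v -> kept_edge c' b' v.
  move=> vc vw; rewrite /kept_edge /edge_src /edge_tgt b'c // -/(edge_src b v) -/(edge_tgt b v).
  rewrite nextc ?srcc //; apply: contraNneq vw => E.
  have bvw : b v = b w.
    apply: (dir_orbit t); apply: connect_trans (srco b v) _.
    by rewrite E r_sym.
  by move: E; rewrite /edge_src bvw; case: (b w) => [/r_inj|] ->.
have keepo v : v \in o -> v != z -> kept_edge c' b' v.
  move=> vo vz; have [sv nv] := nextq v vo vz.
  by rewrite /kept_edge nexto ?nv // qo oE; apply: connect_trans (srco b' v); rewrite -oE.
have c'P v : (v \in c') = (v \in c) || (v \in o) by rewrite c'E mem_cat qo.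
exists c', b'; split; last first.
  rewrite (perm_size (_ : perm_eq c' (c ++ q))); last first.
    apply: uniq_perm => //; first by case/andP: cyc'.
    by rewrite cat_uniq disj Uq; case/andP: (tour_cycle t) => _ ->.
  rewrite size_cat -[X in X < _]addn0 ltn_add2l.
  by have := qo z; rewrite oE connect0; case: (q).
split=> //.
- by move=> v; rewrite c'P => /orP[/(tour_P t)|/oP].
- move=> v; rewrite !c'P => /orP[/(tour_r t)->//|vo].
  by rewrite oE -same_fconnect1_r // -oE vo orbT.
- by move=> v; rewrite /b' -same_fconnect1_r // (tour_dir t).
move=> v; rewrite c'P => /orP[vc|vo]; last first.
  have zv : fconnect r z v by rewrite -oE.
  apply: (@leq_trans 1).
    rewrite -(cards1 z); apply/subset_leq_card/subsetP => v'.
    rewrite !inE => /andP[vv' /negP nk]; case: eqP => // /eqP v'z; case: nk.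
    by apply: keepo => //; rewrite oE (connect_trans zv).
  rewrite card_gt0; apply/set0Pn; exists (froot r w).
  have [z1 xz1 gyz1] : exists2 z1, fconnect r x z1 & g v z1.
    by apply: (orbit_transport (x := y) g_rr); rewrite 1?g_sym // (connect_trans yz).
  apply/imsetP; exists z1.
    by rewrite inE gyz1 c'P -(tour_orbit t xz1) xc.
  by apply/eqP; rewrite froot_eq; apply: connect_trans xz1; rewrite r_sym.
have sub : [set froot r y | y in [pred y | g v y && (y \in c)]]
   \subset [set froot r y | y in [pred y | g v y && (y \in c')]].
  apply: imsetS; apply/subsetP => u; rewrite !inE => /andP[-> uc].
  by rewrite c'P uc.
have memc v' : fconnect r v v' -> v' \in c by move/(tour_orbit t) => <-.
case: (boolP (fconnect r v w)) => [vw|nvw].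
  apply: (@leq_trans #|w |: [set v' in fconnect r v | ~~ kept_edge c b v']|).
    apply/subset_leq_card/subsetP => v'; rewrite !inE => /andP[vv' nk].
    case: eqP => //= /eqP v'w; rewrite vv'; apply: contra nk.
    by apply: keepc => //; apply: memc.
  apply: leq_trans (_ : #|[set v' in fconnect r v | ~~ kept_edge c b v']|.+1 <= _).
    by rewrite cardsU1 -addn1 addnC leq_add ?leq_b1.
  apply: leq_ltn_trans (tour_cap t vc) _; apply: proper_card.
  apply/properP; split=> //; exists (froot r z).
    have [z1 yz1 gvz1] : exists2 z1, fconnect r y z1 & g v z1.
      apply: (orbit_transport g_rr gxy); apply: connect_trans xw _; by rewrite r_sym.
    apply/imsetP; exists z1.
      by rewrite inE gvz1 c'P oE (connect_trans _ yz1) ?orbT // r_sym.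
    apply/eqP; rewrite froot_eq; apply: connect_trans yz1; by rewrite r_sym.
  apply: contra zc => /imsetP[u /andP[_ uc] /eqP].
  by rewrite froot_eq => /(tour_orbit t) ->.
apply: leq_trans (subset_leq_card sub); apply: leq_trans (tour_cap t vc).
apply/subset_leq_card/subsetP => v'; rewrite !inE => /andP[vv' nk].
rewrite vv'; apply: contra nk; apply: keepc; first exact: memc.
by apply: contraNneq nvw => <-.
Qed.

Theorem hamiltonian_of_orbits x0 : P x0 ->
  exists c, ucycle e c /\ c =i P.
Proof.
move=> Px0.
suff grow k c b : #|V| - size c < k -> 0 < size c -> partial_tour c b ->
    exists c, ucycle e c /\ c =i P.
  apply: (grow _ _ _ (ltnSn _) _ (tour_start Px0)).
  by rewrite size_orbit order_gt0.
elim: k c b => // k IHk c b sk c0 t.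
case: (pickP [pred x | (x \in c) && [exists y, g x y && (y \notin c)]])
    => [x /andP[xc /existsP[y /andP[gxy yc]]]|closedc].
  have [c' [b' [t' lt]]] := tour_grow t xc gxy yc.
  have szc' : size c' <= #|V|.
    by rewrite -(card_uniqP _) ?max_card //; case/andP: (tour_cycle t').
  by apply: (IHk c' b') => //; lia.
exists c; split; first exact: tour_cycle t.
move=> y; apply/idP/idP => [/(tour_P t)//|Py].
case: c c0 {sk} t closedc => // x c _ t closedc.
have xc := mem_head x c.
have cl : closed g (mem (x :: c)).
  apply: intro_closed => [|u v guv uc]; first exact: sym_connect_sym.
  have /negbT := closedc u; rewrite inE uc /= => /existsPn/(_ v).
  by rewrite guv negbK.
by rewrite -(closed_connect cl (g_conn (tour_P t xc) Py)) xc.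
Qed.

End Gluing.

(** * Noncrossing families of diagonals and their maximality *)

Section Combinatorics.

(** [cyc a b c]: the three vertices are distinct and [b] comes before [c] on the
    way round the polygon from [a].  Linear inequalities keep all statements about
    cyclic order within linear arithmetic. *)
Definition cyc (a b c : nat) : bool :=
  [|| (a < b) && (b < c), (b < c) && (c < a) | (c < a) && (a < b)].

Definition crossing (a b c d : nat) : bool :=
  (cyc a c b && cyc b d a) || (cyc a d b && cyc b c a).

Variable n : nat.
Implicit Types (i j k l a b c : 'I_n) (d e f : {set 'I_n}).

(** The numerical form of being distinct and not consecutive modulo [n]. *)
Definition apart (a b : nat) : bool :=
  ((1 < a - b) && (a - b < n.-1)) || ((1 < b - a) && (b - a < n.-1)).

Definition crosses d e : bool :=
  [exists a in d, exists b in d, exists c in e, exists x in e,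
     cyc a c b && cyc b x a].

Lemma eq_ordE i j : (i == j) = (i == j :> nat).
Proof. by []. Qed.

Lemma ordSP i : i.+1 < n /\ ordS i = i.+1 :> nat \/ i.+1 = n /\ ordS i = 0 :> nat.
Proof.
have := ltn_ord i; rewrite leq_eqVlt /= => /orP[/eqP->|lti].
  by right; rewrite modnn.
by left; rewrite modn_small.
Qed.

Lemma is_diagonal2 a b : is_diagonal [set a; b] = apart a b.
Proof.
have ha := ltn_ord a; have hb := ltn_ord b.
have eqm i j : (i == j.+1 %[mod n]) = (i == ordS j :> nat).
  by rewrite /= modn_small.
apply/andP/idP => [[+ /forall_inP H]|ab].
  rewrite cards2; case: (altP (a =P b)) => // nab _.
  have /forall_inP/(_ b (set22 _ _)) := H a (set21 _ _).
  have /forall_inP/(_ a (set21 _ _)) := H b (set22 _ _).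
  rewrite !eqm /apart; have : a != b :> nat := nab.
  have := ordSP a; have := ordSP b; lia.
have nab : a != b by apply: contraTneq ab => ->; rewrite /apart; lia.
rewrite cards2 nab; split=> //; apply/forall_inP => i ii; apply/forall_inP => j jj.
have := ordSP j; move: ii jj ab.
by rewrite eqm /apart !inE => /orP[]/eqP-> /orP[]/eqP->; lia.
Qed.

Lemma is_diagonalP d : is_diagonal d -> exists a b, d = [set a; b] /\ apart a b.
Proof.
move=> dd; have /cards2P[a [b [_ E]]] : #|d| == 2 by case/andP: dd.
by exists a, b; rewrite -is_diagonal2 -E.
Qed.

Lemma crosses2 a b i j : crosses [set a; b] [set i; j] = crossing a b i j.
Proof.
apply/exists_inP/idP; last first.
  case/orP=> H; exists a; rewrite ?set21 //; apply/exists_inP; exists b;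
    rewrite ?set22 //; apply/exists_inP.
    by exists i; rewrite ?set21 //; apply/exists_inP; exists j; rewrite ?set22.
  by exists j; rewrite ?set22 //; apply/exists_inP; exists i; rewrite ?set21.
case=> x xd /exists_inP[y yd /exists_inP[z zd /exists_inP[t td]]].
move: xd yd zd td; rewrite !inE /crossing /cyc.
by move=> /orP[]/eqP-> /orP[]/eqP-> /orP[]/eqP-> /orP[]/eqP->; lia.
Qed.

Lemma crossingC (a b c d : nat) : crossing a b c d = crossing c d a b.
Proof. rewrite /crossing /cyc; lia. Qed.

Lemma crossesC d e : is_diagonal d -> is_diagonal e -> crosses d e = crosses e d.
Proof.
move=> /is_diagonalP[a [b [-> _]]] /is_diagonalP[a' [b' [-> _]]].
by rewrite !crosses2 crossingC.
Qed.

Definition rotd d : {set 'I_n} := @ordS n @: d.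
Definition rotT (T : {set {set 'I_n}}) := rotd @: T.

Definition triangulation (T : {set {set 'I_n}}) : bool :=
  [&& [forall d in T, is_diagonal d], #|T| == n - 3
    & [forall d in T, forall e in T, ~~ crosses d e]].

Lemma triangulationP (T : {set {set 'I_n}}) :
  reflect [/\ {in T, forall d, is_diagonal d}, #|T| = n - 3
            & {in T &, forall d e, ~~ crosses d e}] (triangulation T).
Proof.
apply: (iffP and3P) => [[/forall_inP D /eqP C /forall_inP X]|[D C X]].
  by split=> // d e dT eT; have /forall_inP/(_ e eT) := X d dT.
split; [exact/forall_inP | exact/eqP |].
by apply/forall_inP => d dT; apply/forall_inP => e eT; apply: X.
Qed.

(** For the longest chord {i, k} from [i] other than {i, j} (or k = i + 1 if there
    is none), every chord inside [i..j] other than {i, j} lies in [i..k] or in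
    [k..j]: one that jumps over k would cross {i, k} or be longer.  So the bound follows by
    induction.  Chords joining the first to the last vertex are allowed here. *)
Lemma noncrossing_interval (D : {set {set 'I_n}}) i j :
  {in D, forall d, exists a b, d = [set a; b] /\ a.+1 < b} ->
  {in D &, forall d e, ~~ crosses d e} ->
  i < j -> #|[set d in D | d \subset [set x : 'I_n | i <= x <= j]]| <= (j - i).-1.
Proof.
move=> Dd Dx.
have [m] := ubnP (j - i); elim: m i j => // m IHm i j ltm ij.
set D' := finset _.
have D'P d : d \in D' -> exists a b : 'I_n,
    [/\ d = [set a; b], d \in D & i <= a /\ a.+1 < b /\ b <= j].
  rewrite inE => /andP[dD /subsetP sub]; have [a [b [dE ab]]] := Dd _ dD.
  have ha : i <= a <= j by have := sub a; rewrite dE set21 inE => /(_ isT).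
  have hb : i <= b <= j by have := sub b; rewrite dE set22 inE => /(_ isT).
  by exists a, b; split=> //; lia.
case: (ltnP i.+1 j) => [ij1|]; last first.
  move=> ji; rewrite (_ : D' = set0) ?cards0 //; apply/setP => d; rewrite [RHS]inE.
  by apply/negP => /D'P[a [b [_ _]]]; lia.
have ltk : i.+1 < n by have := ltn_ord j; lia.
pose k0 := Ordinal ltk.
pose Q := [pred k : 'I_n | (i < k < j) && ((k == k0) || ([set i; k] \in D))].
have Qk0 : Q k0 by rewrite /= eqxx; lia.
case: (@arg_maxnP _ k0 Q (@nat_of_ord n) Qk0) => k /andP[ikj kD] kmax.
have kmax' (b : 'I_n) : i < b < j -> [set i; b] \in D -> b <= k.
  by move=> ibj ibD; apply: kmax; rewrite /= ibj ibD orbT.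
pose Dk (u v : 'I_n) := [set d in D | d \subset [set x : 'I_n | u <= x <= v]].
have sub : D' \subset [set i; j] |: (Dk i k :|: Dk k j).
  apply/subsetP => d /D'P[a [b [dE dD hab]]].
  have insub (u v : 'I_n) : u <= a -> b <= v -> d \in Dk u v.
    move=> ua bv; rewrite inE dD; apply/subsetP => x; rewrite dE !inE => /orP[]/eqP->; lia.
  rewrite !in_setU in_set1.
  case: (leqP b k) => [bk|kb]; first by rewrite insub ?orbT //; lia.
  case: (leqP k a) => [ka|ak]; first by rewrite (insub k j) ?orbT //; lia.
  suff [ai bj] : a = i /\ b = j by rewrite dE ai bj eqxx.
  have ai : a = i.
    apply/val_inj => /=; case/orP: kD => [/eqP kk|kD]; first by move: ak; rewrite kk /=; lia.
    have := Dx _ _ kD dD; rewrite dE crosses2 /crossing /cyc; lia.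
  split=> //; apply/val_inj => /=; case: (ltnP b j) => bj; last by lia.
  have : b <= k by apply: kmax'; [lia | rewrite -ai -dE].
  lia.
apply: leq_trans (subset_leq_card sub) _.
have cik : #|Dk i k| <= (k - i).-1 by apply: IHm; lia.
have ckj : #|Dk k j| <= (j - k).-1 by apply: IHm; lia.
rewrite cardsU1; apply: (@leq_trans (1 + (#|Dk i k| + #|Dk k j|))); last by lia.
by rewrite leq_add ?leq_b1 // cardsU leq_subr.
Qed.

(** The side joining the last vertex to the first crosses nothing and can be added
    to the family, which saves one in the bound for the whole interval. *)
Lemma noncrossing_card (D : {set {set 'I_n}}) : 2 < n ->
  {in D, forall d, is_diagonal d} -> {in D &, forall d e, ~~ crosses d e} ->
  #|D| <= n - 3.
Proof.
move=> n_gt2 Dd Dx.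
have n0 : 0 < n by lia.
have n1 : n.-1 < n by lia.
pose o := Ordinal n0; pose m := Ordinal n1.
have omD : [set o; m] \notin D.
  by apply/negP => /Dd; rewrite is_diagonal2 /apart /=; lia.
have omx a b : ~~ crossing o m a b /\ ~~ crossing a b o m.
  by rewrite /crossing /cyc /=; have := ltn_ord a; have := ltn_ord b; lia.
have chord d : d \in [set o; m] |: D -> exists a b, d = [set a; b] /\ a.+1 < b.
  case/setU1P=> [->|/Dd/is_diagonalP[a [b [-> ab]]]].
    by exists o, m; split=> //=; lia.
  case: (ltnP a b) => lab; [exists a, b | exists b, a; rewrite setUC].
    by split=> //; move: ab; rewrite /apart; lia.
  by split=> //; move: ab; rewrite /apart; lia.
have nx : {in [set o; m] |: D &, forall d e, ~~ crosses d e}.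
  move=> d e; case/setU1P=> [->|dD]; case/setU1P=> [->|eD]; last exact: Dx.
  - by rewrite crosses2; case: (omx o m).
  - have [a [b [-> _]]] := chord e (setU1r _ eD).
    by rewrite crosses2; case: (omx a b).
  have [a [b [-> _]]] := chord d (setU1r _ dD).
  by rewrite crosses2; case: (omx a b).
have om : o < m by rewrite /=; lia.
have := noncrossing_interval chord nx om.
rewrite (_ : finset _ = [set o; m] |: D) ?cardsU1 ?omD /=; first by lia.
apply/setP => d; rewrite inE andb_idr // => _; apply/subsetP => x _.
by rewrite inE /=; have := ltn_ord x; lia.
Qed.

(** A side of the polygon or a diagonal of [T], hence an edge of a triangle. *)
Definition edge (T : {set {set 'I_n}}) i j : bool :=
  (i != j) && (apart i j ==> ([set i; j] \in T)).

Lemma edgeC T i j : edge T i j = edge T j i.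
Proof. by rewrite /edge eq_sym (setUC [set i]) /apart orbC. Qed.

Lemma apart_neq i j : apart i j -> i != j.
Proof. by apply: contraTneq => ->; rewrite /apart; lia. Qed.

Lemma triangulation_edge T i j : triangulation T -> [set i; j] \in T -> edge T i j.
Proof.
move=> /triangulationP[D _ _] ijT; rewrite /edge ijT implybT andbT.
by apply: apart_neq; rewrite -is_diagonal2 D.
Qed.

Lemma triangulation_maximal T i j : 2 < n -> triangulation T -> apart i j ->
  {in T, forall d, ~~ crosses [set i; j] d} -> [set i; j] \in T.
Proof.
move=> n2 /triangulationP[D C X] aij ijx; apply: contraT => ijT.
have := @noncrossing_card ([set i; j] |: T) n2; rewrite cardsU1 ijT C.
have dij : is_diagonal [set i; j] by rewrite is_diagonal2.
move=> H; suff : 1 + (n - 3) <= n - 3 by lia.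
apply: H => [d /setU1P[->|/D]//|d e /setU1P[->|dT] /setU1P[->|eT]]; last exact: X.
- by rewrite crosses2 /crossing /cyc; lia.
- exact: ijx.
by rewrite (crossesC (D _ dT) dij) ijx.
Qed.

Lemma edge_noncrossing T i j a b : triangulation T -> edge T i j -> [set a; b] \in T ->
  ~~ crossing i j a b.
Proof.
move=> /triangulationP[D C X] /andP[ij] + abT; case: (boolP (apart i j)) => [_ /= ijT|].
  by rewrite -crosses2; apply: X.
have := ltn_ord i; have := ltn_ord j; have := ltn_ord a; have := ltn_ord b.
have : i != j :> nat := ij.
by rewrite /apart /crossing /cyc; lia.
Qed.

(** The third vertex of the triangle beyond {i, j} is the last [k] before [j] that
    is joined to [i]: a diagonal of [T] crossing {k, j} but neither {i, j} nor
    {i, k} would have to start at [i] and go past [k].  By maximality {k, j} is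
    then an edge. *)
Lemma apex T i j : 2 < n -> triangulation T -> edge T i j -> j != ordS i ->
  exists k, [/\ cyc i k j, edge T i k & edge T k j].
Proof.
move=> n2 tT eij jS.
have hi := ltn_ord i; have hj := ltn_ord j.
have ij : i != j :> nat by case/andP: eij.
(* The distance from [i] to [x] when walking round the polygon. *)
pose pos (x : 'I_n) := if i <= x then x - i else x + n - i.
have posP (x : 'I_n) : i <= x /\ pos x = x - i \/ x < i /\ pos x = x + n - i.
  by rewrite /pos; case: leqP => h; [left|right].
have cycS : cyc i (ordS i) j.
  have : j != ordS i :> nat := jS.
  have := ordSP i; rewrite /cyc; lia.
have eS : edge T i (ordS i).
  apply/andP; split; first by rewrite -val_eqE /=; have := ordSP i; rewrite /=; lia.
  by apply/implyP; have := ordSP i; rewrite /apart; lia.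
pose Q := [pred k : 'I_n | cyc i k j && edge T i k].
have QS : Q (ordS i) by rewrite /= cycS.
case: (@arg_maxnP _ (ordS i) Q pos QS) => k /andP[ikj eik] kmax.
exists k; split=> //; have hk := ltn_ord k.
have kj : k != j :> nat by move: ikj; rewrite /cyc; lia.
apply/andP; split=> //; apply/implyP => akj.
apply: triangulation_maximal => // d dT; have [D _ _] := triangulationP _ tT.
have [a [b [dE ab]]] := is_diagonalP (D d dT).
rewrite dE crosses2 /crossing; apply/negP.
suff main a' b' : [set a'; b'] \in T -> cyc k a' j -> cyc j b' k -> False.
  case/orP=> /andP[xa xb]; first by apply: (main a b) => //; rewrite -dE.
  by apply: (main b a) => //; rewrite setUC -dE.
move=> {a b dE ab dT D} abT kaj jbk.
have x1 := edge_noncrossing tT eij abT.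
have x2 := edge_noncrossing tT eik abT.
have [ib|ib] := eqVneq i b'.
  have : pos a' <= pos k.
    apply: kmax; rewrite /= triangulation_edge //; last by rewrite ib setUC.
    by rewrite andbT; move: ikj kaj; rewrite /cyc; clear; lia.
  have := posP a'; have := posP k; have := ltn_ord a'.
  by move: ikj kaj; rewrite /cyc; clear -hi hj hk; lia.
have [cases|cases] : cyc j b' i \/ cyc i b' k.
  by move: jbk ikj (ib : i != b' :> nat); rewrite /cyc; clear; lia.
- case/negP: x1; apply/orP; left; rewrite cases andbT.
  by move: ikj kaj; rewrite /cyc; clear; lia.
case/negP: x2; apply/orP; right; rewrite cases.
by move: ikj kaj; rewrite /cyc; clear; lia.
Qed.

End Combinatorics.

(** * Flips *)

Section Flips.

Variable n : nat.
Hypothesis n_gt4 : 4 < n.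
Implicit Types (i j k l a b c : 'I_n) (d e f : {set 'I_n}).
Implicit Types T : {set {set 'I_n}}.

Let n_gt2 : 2 < n := ltn_trans (isT : 2 < 3) (ltnW n_gt4).

Definition flip_at T i j k l : {set {set 'I_n}} :=
  [set k; l] |: (T :\ [set i; j]).

(** The two triangles of [T] on either side of its diagonal {i, j} form the
    quadrilateral i, k, j, l, in this cyclic order. *)
Record quad T i j k l : Prop := Quad {
  quad_triangulation : triangulation T;
  quad_diag : [set i; j] \in T;
  quad_k : [/\ cyc i k j, edge T i k & edge T k j];
  quad_l : [/\ cyc j l i, edge T j l & edge T l i]
}.

Lemma triangulation_apart T i j : triangulation T -> [set i; j] \in T -> apart n i j.
Proof. by move=> /triangulationP[D _ _] ijT; rewrite -is_diagonal2 D. Qed.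

Lemma quad_exists T i j : triangulation T -> [set i; j] \in T ->
  exists k l, quad T i j k l.
Proof.
move=> tT ijT; have aij := triangulation_apart tT ijT.
have eij := triangulation_edge tT ijT.
have hi := ltn_ord i; have hj := ltn_ord j.
have [|k Hk] := apex n_gt2 tT eij.
  by rewrite -val_eqE /=; have := ordSP i; move: aij; rewrite /apart /=; clear -hi hj; lia.
have eji : edge T j i by rewrite edgeC.
have [|l Hl] := apex n_gt2 tT eji.
  by rewrite -val_eqE /=; have := ordSP j; move: aij; rewrite /apart /=; clear -hi hj; lia.
by exists k, l; split.
Qed.

Lemma quad_apart T i j k l : quad T i j k l -> apart n k l.
Proof.
case=> _ _ [ikj _ _] [jli _ _].
have hi := ltn_ord i; have hj := ltn_ord j; have hk := ltn_ord k; have hl := ltn_ord l.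
by move: ikj jli; rewrite /cyc /apart; clear -hi hj hk hl; lia.
Qed.

Lemma quad_crossing T i j k l : quad T i j k l -> crossing i j k l.
Proof. by case=> _ _ [ikj _ _] [jli _ _]; rewrite /crossing ikj jli. Qed.

Lemma quad_notin T i j k l : quad T i j k l -> [set k; l] \notin T.
Proof.
move=> q; have [_ _ X] := triangulationP _ (quad_triangulation q).
apply/negP => klT; have := X _ _ (quad_diag q) klT.
by rewrite crosses2 (quad_crossing q).
Qed.

(** A diagonal that crosses {k, l} leaves the quadrilateral through none of its
    sides, so that it is its other diagonal {i, j}. *)
Lemma quad_new_noncrossing T i j k l d : quad T i j k l ->
  d \in T :\ [set i; j] -> ~~ crosses [set k; l] d.
Proof.
move=> q /setD1P[dij dT]; have tT := quad_triangulation q.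
have [D _ _] := triangulationP _ tT.
have [a [b [dE ab]]] := is_diagonalP (D d dT).
have [ikj ik kj] := quad_k q; have [jli jl li] := quad_l q.
suff main a' b' : [set a'; b'] \in T -> cyc k a' l -> cyc l b' k ->
    [set a'; b'] = [set i; j].
  apply: contraNN dij; rewrite dE crosses2 => /orP[]/andP[ka lb].
    by rewrite (main a b) // -dE.
  by rewrite setUC (main b a) // setUC -dE.
move=> {a b dE ab dT D dij} abT kal lbk.
have nx (u v : 'I_n) : edge T u v -> cyc u a' v -> cyc v b' u -> False.
  move=> uv ua vb; have := edge_noncrossing tT uv abT.
  by rewrite /crossing ua vb.
have nx' (u v : 'I_n) : edge T u v -> cyc u b' v -> cyc v a' u -> False.
  move=> uv ua vb; have := edge_noncrossing tT uv abT.
  by rewrite /crossing ua vb orbT.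
have aj : a' = j.
  apply/val_inj/eqP => /=; apply: contraT => aj.
  have [C|C] : cyc k a' j \/ cyc j a' l.
    by move: aj kal ikj jli; rewrite /cyc; clear; lia.
  - case: (nx k j) => //; move: C kal lbk ikj jli; rewrite /cyc; clear; lia.
  by case: (nx j l) => //; move: C kal lbk ikj jli; rewrite /cyc; clear; lia.
have bi : b' = i.
  apply/val_inj/eqP => /=; apply: contraT => bi.
  have [C|C] : cyc l b' i \/ cyc i b' k.
    by move: bi lbk ikj jli; rewrite /cyc; clear; lia.
  - case: (nx' l i) => //; move: C kal lbk ikj jli; rewrite /cyc; clear; lia.
  by case: (nx' i k) => //; move: C kal lbk ikj jli; rewrite /cyc; clear; lia.
by rewrite aj bi setUC.
Qed.

Lemma flip_triangulation T i j k l : quad T i j k l -> triangulation (flip_at T i j k l).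
Proof.
move=> q; have [D C X] := triangulationP _ (quad_triangulation q).
have nkl : is_diagonal [set k; l] by rewrite is_diagonal2 (quad_apart q).
have new d := quad_new_noncrossing (d := d) q.
apply/triangulationP; split.
- by move=> d /setU1P[->//|/setD1P[_ /D]].
- have := cardsD1 [set i; j] T; rewrite (quad_diag q) => E.
  by rewrite cardsU1 !inE (negbTE (quad_notin q)) andbF -E.
move=> d e /setU1P[->|dT] /setU1P[->|eT].
- by rewrite crosses2 /crossing /cyc; clear; lia.
- exact: new.
- rewrite crossesC ?new //; apply: D; by case/setD1P: dT.
by apply: X; [case/setD1P: dT | case/setD1P: eT].
Qed.

Definition flips T T' : bool :=
  [&& triangulation T, triangulation T', T' != T & [exists d in T, T :\ d \subset T']].

(** The diagonal replacing {i, j} must cross it, by maximality of [T], and may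
    cross no side of the quadrilateral; hence it is {k, l}. *)
Lemma flip_unique T T' i j k l : quad T i j k l -> triangulation T' -> T' != T ->
  T :\ [set i; j] \subset T' -> T' = flip_at T i j k l.
Proof.
move=> q tT' neq sub; have tT := quad_triangulation q.
have [D C X] := triangulationP _ tT; have [D' C' X'] := triangulationP _ tT'.
have cT : (#|T :\ [set i; j]|).+1 = n - 3.
  by have := cardsD1 [set i; j] T; rewrite (quad_diag q) C.
have [d /setDP[dT' dnT]] : exists d, d \in T' :\: (T :\ [set i; j]).
  by apply/card_gt0P; rewrite cardsD (setIidPr sub) C' -cT subSnn.
have T'E : T' = d |: (T :\ [set i; j]).
  apply/esym/eqP; rewrite eqEcard; apply/andP; split.
    by apply/subsetP => e /setU1P[->//|/(subsetP sub)].
  by rewrite cardsU1 dnT C' -cT.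
have dT : d \notin T.
  apply: contra neq => dT; rewrite T'E.
  have -> : d = [set i; j] by apply/eqP; move: dnT; rewrite !inE dT andbT negbK.
  by rewrite setD1K ?(quad_diag q).
have [x [y [dE xy]]] := is_diagonalP (D' d dT').
suff main a b : d = [set a; b] -> cyc i a j -> cyc j b i -> [set a; b] = [set k; l].
  rewrite T'E /flip_at; congr (_ |: _).
  have [|nx] := boolP (crossing i j x y).
    case/orP=> /andP[ix jy]; first by rewrite dE (main x y).
    by rewrite dE setUC (main y x) // setUC.
  case/negP: dT; rewrite dE; apply: (triangulation_maximal n_gt2 tT xy) => e eT.
  have [->|ne] := eqVneq e [set i; j]; first by rewrite crosses2 crossingC.
  by rewrite -dE; apply: X' => //; apply: (subsetP sub); apply/setD1P.
move=> {x y xy dE} dE iaj jbi.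
have eqT u v : edge T u v -> [set u; v] != [set i; j] -> ~~ crossing a b u v.
  have ha := ltn_ord a; have hb := ltn_ord b; have hu := ltn_ord u; have hv := ltn_ord v.
  case/andP => uv; case: (boolP (apart n u v)) => [_ /= uvT ne|nuv _ _].
    by rewrite -crosses2 -dE; apply: X' => //; apply: (subsetP sub); apply/setD1P.
  by move: nuv (uv : u != v :> nat); rewrite /crossing /cyc /apart; clear -ha hb hu hv; lia.
have ij_neq u v (x : 'I_n) : x \in [set i; j] -> x != u -> x != v ->
    [set u; v] != [set i; j].
  by move=> xij xu xv; apply: contraL xij => /eqP <-; rewrite !inE negb_or xu.
have [ikj ik kj] := quad_k q; have [jli jl li] := quad_l q.
have ak : a = k.
  apply/val_inj/eqP => /=; apply: contraT => ak.
  have [C0|C0] : cyc i a k \/ cyc k a j.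
    by move: ak iaj ikj; rewrite /cyc; clear; lia.
  - have nik : [set i; k] != [set i; j].
      by apply: (ij_neq i k j); rewrite ?set22 // eq_ordE;
        move: ikj; rewrite /cyc; clear; lia.
    case/negP: (eqT _ _ ik nik).
    by move: C0 iaj jbi ikj; rewrite /crossing /cyc; clear; lia.
  have nkj : [set k; j] != [set i; j].
    by apply: (ij_neq k j i); rewrite ?set21 // eq_ordE;
        move: ikj; rewrite /cyc; clear; lia.
  case/negP: (eqT _ _ kj nkj).
  by move: C0 iaj jbi ikj; rewrite /crossing /cyc; clear; lia.
have bl : b = l.
  apply/val_inj/eqP => /=; apply: contraT => bl.
  have [C0|C0] : cyc j b l \/ cyc l b i.
    by move: bl jbi jli; rewrite /cyc; clear; lia.
  - have njl : [set j; l] != [set i; j].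
      by apply: (ij_neq j l i); rewrite ?set21 // eq_ordE;
        move: jli; rewrite /cyc; clear; lia.
    case/negP: (eqT _ _ jl njl).
    by move: C0 iaj jbi jli; rewrite /crossing /cyc; clear; lia.
  have nli : [set l; i] != [set i; j].
    by apply: (ij_neq l i j); rewrite ?set22 // eq_ordE;
        move: jli; rewrite /cyc; clear; lia.
  case/negP: (eqT _ _ li nli).
  by move: C0 iaj jbi jli; rewrite /crossing /cyc; clear; lia.
by rewrite ak bl.
Qed.

Lemma quad_flips T i j k l : quad T i j k l -> flips T (flip_at T i j k l).
Proof.
move=> q; rewrite /flips (quad_triangulation q) flip_triangulation //=; apply/andP; split.
  by apply: contraNneq (quad_notin q) => <-; apply: setU11.
by apply/exists_inP; exists [set i; j]; [exact: quad_diag q | exact: subsetUr].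
Qed.

Lemma flipsP T T' : flips T T' -> exists i j k l,
  quad T i j k l /\ T' = flip_at T i j k l.
Proof.
case/and4P=> tT tT' neq /exists_inP[d dT sub].
have [D _ _] := triangulationP _ tT; have [i [j [dE _]]] := is_diagonalP (D d dT).
rewrite {}dE in dT sub; have [k [l q]] := quad_exists tT dT.
by exists i, j, k, l; split=> //; apply: flip_unique sub.
Qed.

Lemma flips_sym : symmetric flips.
Proof.
suff sym T T' : flips T T' -> flips T' T by move=> T T'; apply/idP/idP; apply: sym.
move=> fl; have [i [j [k [l [q T'E]]]]] := flipsP fl.
case/and4P: fl => tT tT' neq _; rewrite /flips tT tT' eq_sym neq /=.
apply/exists_inP; exists [set k; l]; first by rewrite T'E setU11.
rewrite T'E; apply/subsetP => d /setD1P[dn /setU1P[/eqP|/setD1P[]//]].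
by rewrite (negbTE dn).
Qed.

Definition fan o : {set {set 'I_n}} := [set [set o; i] | i : 'I_n & apart n o i].

Let o := Ordinal (ltnW (ltnW n_gt2)).

Lemma card_apart : #|[set i : 'I_n | apart n o i]| = n - 3.
Proof.
have n1 : n.-1 < n by lia.
have n2 : 1 < n by lia.
pose s := Ordinal n2; pose m := Ordinal n1.
have := cardsC [set i : 'I_n | apart n o i]; rewrite card_ord.
rewrite (_ : ~: _ = o |: [set s; m]); last first.
  apply/setP => i; have := ltn_ord i.
  by rewrite !inE -!val_eqE /apart /=; lia.
have nsm : s != m by rewrite -val_eqE /=; clear -n_gt4; lia.
have nosm : o \notin [set s; m] by rewrite !inE -!val_eqE /=; clear -n_gt4; lia.
by rewrite cardsU1 cards2 nosm nsm /=; lia.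
Qed.

Lemma card_fan : #|fan o| = n - 3.
Proof.
rewrite card_in_imset ?card_apart // => i j; rewrite !inE => oi oj E.
have : i \in [set o; j] by rewrite -E set22.
by rewrite !inE eq_sym (negbTE (apart_neq oi)) => /eqP.
Qed.

Lemma triangulation_fan T : triangulation T -> (forall i, i != o -> edge T o i) -> T = fan o.
Proof.
move=> tT all_edge; have [D C _] := triangulationP _ tT; apply/esym/eqP; rewrite eqEcard.
apply/andP; split.
  apply/subsetP => _ /imsetP[i + ->]; rewrite inE => oi.
  have io : i != o by rewrite eq_sym (apart_neq oi).
  by have /andP[_ /implyP] := all_edge i io; apply.
by rewrite C card_fan.
Qed.

(** If vertex 0 is joined to [i] but not to [i + 1], the triangle beyond {i, 0}
    has a third vertex [k] other than [i + 1], and flipping {i, k} adds one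
    diagonal at vertex 0.  When this is no longer possible, [T] is the fan. *)
Lemma flips_fan T : triangulation T -> connect flips T (fan o).
Proof.
have [m] := ubnP (n - #|[set d in T | o \in d]|); elim: m T => // m IHm T ltm tT.
case: (pickP [pred i | (i != o) && ~~ edge T o i]) => [i0 Qi0|all_edge]; last first.
  rewrite -(triangulation_fan tT) ?connect0 // => i io.
  by have := all_edge i; rewrite /= io => /negbFE.
case: (@arg_minnP _ i0 _ (@nat_of_ord n) Qi0) => i' /andP[io' eoi'] imin.
have hi' := ltn_ord i'.
have i'0 : 0 < i' by rewrite lt0n; exact: io'.
have i'1 : i' != 1 :> nat.
  apply: contraNneq eoi' => i'1; apply/andP; split; first by rewrite eq_sym.
  by rewrite /apart i'1 /=; apply/implyP; clear; lia.
have ltj : i'.-1 < n by lia.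
pose i := Ordinal ltj.
have io : i != o by rewrite -val_eqE /=; clear -i'0 i'1; lia.
have eoi : edge T o i.
  apply: contraT => noi; have := imin i; rewrite /= io noi => /(_ isT).
  clear -i'0; lia.
have eio : edge T i o by rewrite edgeC.
have i'E : i' = i.+1 :> nat by rewrite /=; clear -i'0; lia.
have [|k [iko eik eko]] := apex n_gt2 tT eio.
  apply/eqP => oE; have := ordSP i; rewrite -oE; have : o = 0 :> nat by [].
  clear -i'E hi'; lia.
have hk := ltn_ord k.
have ki' : k != i' :> nat by apply: contraNneq eoi' => /val_inj <-; rewrite edgeC.
have ik : i < k by move: iko; rewrite /cyc; have : o = 0 :> nat by []; clear; lia.
have aik : apart n i k.
  rewrite /apart; have i0' : i != 0 :> nat := io.
  by clear -hk ik i'E ki' i0'; lia.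
have ikT : [set i; k] \in T by case/andP: eik => _; rewrite aik.
have [|x [ixk eix exk]] := apex n_gt2 tT eik.
  by apply/eqP => kE; have := ordSP i; rewrite -kE; clear -i'E hi' ki'; lia.
have q : quad T i k x o.
  by split=> //; split=> //; move: iko; rewrite /cyc; clear; lia.
have fl := quad_flips q.
apply: connect_trans (connect1 fl) _; apply: IHm; last exact: flip_triangulation.
have cT : #|[set d in T | o \in d]| <= n - 3.
  have [_ <- _] := triangulationP _ tT; apply/subset_leq_card/subsetP => d.
  by rewrite inE => /andP[].
suff : #|[set d in T | o \in d]| < #|[set d in flip_at T i k x o | o \in d]|.
  by move: ltm cT; clear -n_gt4; lia.
apply: proper_card; apply/properP; split.
  apply/subsetP => d; rewrite !inE => /andP[dT od]; rewrite od dT andbT.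
  apply/orP; right; rewrite andbT; apply: contraTneq od => ->.
  rewrite !inE negb_or eq_sym io /=.
  by rewrite -val_eqE /=; clear -ik; lia.
exists [set x; o]; first by rewrite !inE !eqxx orbT.
by rewrite inE (negbTE (quad_notin q)).
Qed.

Lemma flips_connected T T' : triangulation T -> triangulation T' -> connect flips T T'.
Proof.
move=> tT tT'; apply: connect_trans (flips_fan tT) _.
by rewrite (sym_connect_sym flips_sym) flips_fan.
Qed.

Lemma fan_triangulation : triangulation (fan o).
Proof.
apply/triangulationP; split; [|exact: card_fan|].
  by move=> _ /imsetP[i + ->]; rewrite is_diagonal2 inE.
move=> _ _ /imsetP[i _ ->] /imsetP[j _ ->].
by rewrite crosses2 /crossing /cyc; clear; lia.
Qed.
End Flips.

(** * Rotating a triangulation *)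

Section Rotation.

Variable n : nat.
Hypothesis n_gt4 : 4 < n.
Implicit Types (i j k l a b c : 'I_n) (d e f : {set 'I_n}).
Implicit Types T : {set {set 'I_n}}.

Lemma rotd2 a b : rotd [set a; b] = [set ordS a; ordS b].
Proof. by rewrite /rotd imsetU1 imset_set1. Qed.

Lemma rotd_inj : injective (@rotd n).
Proof. exact/imset_inj/(can_inj (@ordSK n)). Qed.

Lemma rotT_inj : injective (@rotT n).
Proof. exact/imset_inj/rotd_inj. Qed.

Lemma rotd_diagonal d : is_diagonal d -> is_diagonal (rotd d).
Proof.
move=> /is_diagonalP[a [b [-> ab]]]; rewrite rotd2 is_diagonal2.
have := ordSP a; have := ordSP b; have := ltn_ord a; have := ltn_ord b.
by move: ab; rewrite /apart; clear -n_gt4; lia.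
Qed.

Lemma cyc_ordS a b c : cyc (ordS a) (ordS b) (ordS c) = cyc a b c.
Proof.
have := ordSP a; have := ordSP b; have := ordSP c.
have := ltn_ord a; have := ltn_ord b; have := ltn_ord c.
by rewrite /cyc; clear; lia.
Qed.

Lemma crosses_rotd d e : is_diagonal d -> is_diagonal e ->
  crosses (rotd d) (rotd e) = crosses d e.
Proof.
move=> /is_diagonalP[a [b [-> _]]] /is_diagonalP[a' [b' [-> _]]].
by rewrite !rotd2 !crosses2 /crossing !cyc_ordS.
Qed.

Lemma rotd_crosses d : is_diagonal d -> crosses d (rotd d).
Proof.
move=> /is_diagonalP[a [b [-> ab]]]; rewrite rotd2 crosses2.
have := ordSP a; have := ordSP b; have := ltn_ord a; have := ltn_ord b.
by move: ab; rewrite /apart /crossing /cyc; clear -n_gt4; lia.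
Qed.

Lemma card_rotT T : #|rotT T| = #|T|.
Proof. exact/card_imset/rotd_inj. Qed.

Lemma triangulation_rotT T : triangulation T -> triangulation (rotT T).
Proof.
move=> /triangulationP[D C X]; apply/triangulationP; split; last 1 first.
- move=> _ _ /imsetP[d dT ->] /imsetP[e eT ->]; rewrite crosses_rotd ?D //; exact: X.
- by move=> _ /imsetP[d dT ->]; apply/rotd_diagonal/D.
by rewrite card_rotT.
Qed.

Lemma rotT_sub T T' d : T :\ d \subset T' -> rotT T :\ rotd d \subset rotT T'.
Proof.
move=> sub; apply/subsetP => f /setD1P[+ /imsetP[e eT fE]].
rewrite fE (inj_eq rotd_inj) => ne.
by apply/imset_f/(subsetP sub)/setD1P.
Qed.

Lemma flips_rotT T T' : flips T T' -> flips (rotT T) (rotT T').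
Proof.
move=> /and4P[tT tT' neq /exists_inP[d dT sub]].
rewrite /flips !triangulation_rotT // (inj_eq rotT_inj) neq /=.
by apply/exists_inP; exists (rotd d); [exact: imset_f | exact: rotT_sub].
Qed.

Lemma disjoint_rotT T : triangulation T -> [disjoint T & rotT T].
Proof.
move=> /triangulationP[D _ X]; apply/pred0P => d; apply/negbTE/negP => /= /andP[dT].
move=> /imsetP[e eT dE]; have := X _ _ eT dT.
by rewrite dE rotd_crosses // D.
Qed.

Lemma rotT_disjoint T T' : [disjoint T & T'] -> [disjoint rotT T & rotT T'].
Proof. by rewrite (imset_disjoint rotd_inj). Qed.

(** If both fail, the common diagonals can only come from the exchanged pair
    d, d': the first failure gives rd' = d and the second rd = d'.  Then d is fixed
    by rotation by two vertices, which forces n = 4. *)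
Lemma flips_link T T' : flips T T' ->
  [disjoint T & rotT T'] || [disjoint rotT T & T'].
Proof.
move=> fl; have [i [j [k [l [q T'E]]]]] := flipsP n_gt4 fl.
have [tT tT' _ _] := and4P fl.
have [D _ X] := triangulationP _ tT; have [D' _ X'] := triangulationP _ tT'.
set d := [set i; j]; set d' := [set k; l].
have d'T' : d' \in T' by rewrite T'E setU11.
have T'sub e : e \in T' -> e = d' \/ e \in T.
  by rewrite T'E => /setU1P[->|/setD1P[]]; [left | right].
have Tsub e : e \in T -> e = d \/ e \in T'.
  move=> eT; have [->|ne] := eqVneq e d; [by left | right].
  by rewrite T'E; apply/setU1P; right; apply/setD1P.
apply: contraT; rewrite negb_or => /andP[/pred0Pn/=[e /andP[eT /imsetP[e' e'T' eE]]]].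
move=> /pred0Pn/=[f /andP[/imsetP[f' f'T fE] fT']].
have no_rot (U : {set {set 'I_n}}) (g : {set 'I_n}) :
    triangulation U -> g \in U -> rotd g \in U -> False.
  move=> tU gU; apply/negP; have := disjoint_rotT tU; rewrite disjoint_sym.
  by move/disjointFr->; last exact: imset_f.
have e'd : e' = d'.
  by case: (T'sub _ e'T') => // e'T; case: (no_rot T e' tT e'T); rewrite -eE.
have ed : e = d.
  by case: (Tsub _ eT) => // eT'; case: (no_rot T' e' tT' e'T'); rewrite -eE.
have fd' : f = d'.
  by case: (T'sub _ fT') => // fT; case: (no_rot T f' tT f'T); rewrite -fE.
have f'd : f' = d.
  by case: (Tsub _ f'T) => // f'T'; case: (no_rot T' f' tT' f'T'); rewrite -fE.
have : rotd (rotd d) = d by rewrite -[in RHS]ed eE e'd -fd' fE f'd.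
have := D _ (quad_diag q); rewrite -/d /d is_diagonal2 !rotd2 => aij rr.
have : ordS (ordS i) \in [set i; j] by rewrite -rr set21.
have : ordS (ordS j) \in [set i; j] by rewrite -rr set22.
rewrite !inE !eq_ordE.
have := ordSP i; have := ordSP j; have := ordSP (ordS i); have := ordSP (ordS j).
by move: aij (ltn_ord i) (ltn_ord j); rewrite /apart; clear -n_gt4; lia.
Qed.

Lemma ordS_iter t i : iter t (@ordS n) i = (i + t) %% n :> nat.
Proof.
elim: t => [|t IH] /=; first by rewrite addn0 modn_small.
by rewrite IH -(addn1 (_ %% _)) modnDml addn1 addnS.
Qed.

Lemma rotd_iter2 t a b :
  iter t (@rotd n) [set a; b] = [set iter t (@ordS n) a; iter t (@ordS n) b].
Proof. by elim: t => //= t ->; rewrite rotd2. Qed.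

Lemma rotT_iter t T : iter t (@rotT n) T = (iter t (@rotd n)) @: T.
Proof.
elim: t => [|t IH] /=; first by rewrite imset_id.
by rewrite IH /rotT -imset_comp.
Qed.

Lemma rotd_period d : iter n (@rotd n) d = d.
Proof.
have it t : iter t (@rotd n) d = iter t (@ordS n) @: d.
  elim: t => [|t IH] /=; first by rewrite imset_id.
  by rewrite IH /rotd -imset_comp.
rewrite it -[RHS]imset_id; apply: eq_imset => i; apply: val_inj.
by rewrite /= ordS_iter modnDr modn_small.
Qed.

Lemma rotT_period T : iter n (@rotT n) T = T.
Proof.
by rewrite rotT_iter -[RHS]imset_id; apply: eq_imset => d; rewrite rotd_period.
Qed.
End Rotation.

(** * Counting the flip neighbours of a triangulation up to rotation *)

Section Few.

Variable n : nat.
Hypothesis n_gt4 : 4 < n.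
Implicit Types (i j k l a b c : 'I_n) (d e f : {set 'I_n}).
Implicit Types T : {set {set 'I_n}}.

Lemma ordS_iterP t a : t < n -> a + t < n /\ iter t (@ordS n) a = a + t :> nat
  \/ n <= a + t /\ iter t (@ordS n) a = a + t - n :> nat.
Proof.
move=> tn; rewrite ordS_iter; have := ltn_ord a.
case: (ltnP (a + t) n) => h an; [left | right]; split=> //.
  by rewrite modn_small.
by rewrite -[in LHS](subnK h) modnDr modn_small //; lia.
Qed.

(** For a diagonal, this means that it is a diameter: a nontrivial rotation has no
    fixed vertex, so it can fix a diagonal only by exchanging its endpoints. *)
Definition self_similar d : bool :=
  [exists t : 'I_n, (0 < t) && (iter t (@rotd n) d == d)].

Lemma self_similarP d : is_diagonal d -> self_similar d ->
  exists a b, [/\ d = [set a; b], a < b & n = (b - a).*2].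
Proof.
move=> dd /existsP[t /andP[t0 /eqP]].
have [a [b [dE ab]]] := is_diagonalP dd; rewrite dE rotd_iter2 => E.
have : iter t (@ordS n) a \in [set a; b] by rewrite -E set21.
have : iter t (@ordS n) b \in [set a; b] by rewrite -E set22.
have := ordS_iterP a (ltn_ord t); have := ordS_iterP b (ltn_ord t).
rewrite !inE !eq_ordE; move: (iter _ _ _) (iter _ _ _) => x y.
have := ltn_ord a; have := ltn_ord b; have := ltn_ord t.
case: (ltnP a b) => lab H1 H2 H3 H4 H5 H6 H7.
  by exists a, b; split=> //; move: H1 H2 H3 H4 H5 H6 H7 lab t0; clear; lia.
have lba : b < a by rewrite ltn_neqAle lab andbT eq_sym; exact: apart_neq ab.
exists b, a; split=> //; first by rewrite setUC.
by move: H1 H2 H3 H4 H5 H6 H7 lba t0; clear; lia.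
Qed.

(** Two different diameters cross. *)
Lemma self_similar_unique T d e : triangulation T -> d \in T -> e \in T ->
  self_similar d -> self_similar e -> d = e.
Proof.
move=> /triangulationP[D _ X] dT eT sd se.
have [a [b [dE ab nab]]] := self_similarP (D _ dT) sd.
have [a' [b' [eE ab' nab']]] := self_similarP (D _ eT) se.
have := X _ _ dT eT; rewrite dE eE crosses2 => nx.
have aa : a = a'.
  apply/val_inj => /=; move: nx (ltn_ord a) (ltn_ord b) (ltn_ord a') (ltn_ord b') ab nab ab' nab'.
  by rewrite /crossing /cyc; clear; lia.
have bb : b = b'.
  by apply/val_inj => /=; move: aa nab ab nab' ab' => ->; clear; lia.
by rewrite aa bb.
Qed.

Definition flip_of T d : {set {set 'I_n}} :=
  odflt T [pick T' | flips T T' && (T :\ d \subset T')].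

Lemma flip_ofP T d : triangulation T -> d \in T ->
  flips T (flip_of T d) /\ T :\ d \subset flip_of T d.
Proof.
move=> tT dT; have [D _ _] := triangulationP _ tT; rewrite /flip_of.
case: pickP => [T' /andP[] //|none].
have [i [j [dE _]]] := is_diagonalP (D _ dT).
have ijT : [set i; j] \in T by rewrite -dE.
have [k [l q]] := quad_exists n_gt4 tT ijT.
by have := none (flip_at T i j k l); rewrite quad_flips //= /flip_at dE subsetUr.
Qed.

Lemma flip_ofE T d T' : triangulation T -> d \in T -> flips T T' -> T :\ d \subset T' ->
  T' = flip_of T d.
Proof.
move=> tT dT fl sub; have [D _ _] := triangulationP _ tT.
have [i [j [dE _]]] := is_diagonalP (D _ dT).
have ijT : [set i; j] \in T by rewrite -dE.
have [k [l q]] := quad_exists n_gt4 tT ijT.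
have [fl2 sub2] := flip_ofP tT dT.
case/and4P: fl => _ tT' neq _; case/and4P: fl2 => _ tT2 neq2 _.
rewrite (flip_unique n_gt4 q tT' neq) -?dE //.
by rewrite (flip_unique n_gt4 q tT2 neq2) -?dE.
Qed.

Lemma flip_of_rot T d t : triangulation T -> d \in T -> iter t (@rotT n) T = T ->
  flip_of T (iter t (@rotd n) d) = iter t (@rotT n) (flip_of T d).
Proof.
move=> tT dT tTT; have [fl sub] := flip_ofP tT dT; apply/esym/flip_ofE => //.
- by rewrite -[in X in _ \in X]tTT rotT_iter imset_f.
- rewrite -[X in flips X]tTT; elim: t {tTT} => //= t; exact: flips_rotT.
rewrite -[X in X :\ _]tTT; elim: t {tTT} => //= t; exact: rotT_sub.
Qed.

Lemma order_dvd T : order (@rotT n) T %| n.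
Proof.
set m := order _ T.
have m0 : 0 < m := order_gt0 _ T.
have E : iter (n %% m) (@rotT n) T = T.
  have mul s : iter (s * m) (@rotT n) T = T.
    by elim: s => // s IH; rewrite mulSn iterD IH; apply/iter_order/rotT_inj.
  have : iter (n %/ m * m + n %% m) (@rotT n) T = T by rewrite -divn_eq rotT_period.
  by rewrite addnC iterD mul.
by rewrite /dvdn -(findex_iter (ltn_pmod n m0)) E findex0.
Qed.

Lemma iter_inj (V : Type) (r : V -> V) t : injective r -> injective (iter t r).
Proof. by move=> ri; elim: t => //= t IH x y /ri/IH. Qed.

(** With m the size of the orbit of [T], the rotation by m fixes [T].  The images
    of [d] under its powers are n / m distinct diagonals of [T], and their flips
    are rotations of the flip of [d]. *)
Lemma orbit_in_fibre T d : triangulation T -> d \in T -> ~~ self_similar d ->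
  n %/ order (@rotT n) T <=
  #|[set e in T | ~~ self_similar e &
      froot (@rotT n) (flip_of T e) == froot (@rotT n) (flip_of T d)]|.
Proof.
move=> tT dT nsd; set m := order _ T; set k := n %/ m.
have m0 : 0 < m := order_gt0 _ T.
have mk : m * k = n by rewrite mulnC divnK // order_dvd.
have mul s : iter (m * s) (@rotT n) T = T.
  by elim: s => [|s IH]; rewrite ?muln0 // mulnS iterD IH; apply/iter_order/rotT_inj.
have inj : injective (fun s : 'I_k => iter (m * s) (@rotd n) d).
  suff lt_inj (s s' : 'I_k) : s < s' ->
      iter (m * s) (@rotd n) d <> iter (m * s') (@rotd n) d.
    move=> s s' /= E; apply/val_inj; case: (ltngtP s s') => // /lt_inj ne.
      by case: (ne E).
    by case: (ne (esym E)).
  move=> ss' E; case/negP: nsd; have lt : m * (s' - s) < n.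
    by rewrite -mk ltn_pmul2l //; have := ltn_ord s'; clear; lia.
  apply/existsP; exists (Ordinal lt); rewrite /= muln_gt0 m0 subn_gt0 ss'.
  apply/eqP; apply: (@iter_inj _ _ (m * s) (@rotd_inj n)).
  by rewrite -iterD mulnBr subnKC // leq_mul2l ltnW // orbT.
rewrite -{1}[k]card_ord -(card_imset _ inj).
apply/subset_leq_card/subsetP => _ /imsetP[s _ ->]; rewrite !inE.
apply/and3P; split.
- have : iter (m * s) (@rotd n) d \in iter (m * s) (@rotT n) T.
    by rewrite rotT_iter imset_f.
  by rewrite mul.
- apply: contra nsd => /existsP[t /andP[t0 /eqP E]]; apply/existsP; exists t.
  rewrite t0; apply/eqP; apply: (@iter_inj _ _ (m * s) (@rotd_inj n)).
  by rewrite -E -!iterD addnC.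
rewrite flip_of_rot // root_connect; last exact: fconnect_sym (@rotT_inj n).
by rewrite fconnect_sym ?fconnect_iter //; apply: rotT_inj.
Qed.

(** The classes without a diameter number at most (n - 3) / (n / m) < m, and a
    diameter contributes at most one more orbit. *)
Lemma flips_few T : triangulation T ->
  #|[set froot (@rotT n) T' | T' in flips T]| <= order (@rotT n) T.
Proof.
move=> tT; set m := order _ T; have [_ cT _] := triangulationP _ tT.
pose phi d := froot (@rotT n) (flip_of T d).
pose D := [set d in T | ~~ self_similar d].
pose C := [set d in T | self_similar d].
have m0 : 0 < m := order_gt0 _ T.
have mk : m * (n %/ m) = n by rewrite mulnC divnK // order_dvd.
have sub : [set froot (@rotT n) T' | T' in flips T] \subset (phi @: D) :|: (phi @: C).
  apply/subsetP => _ /imsetP[T' fl ->]; rewrite -imsetU.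
  have [_ _ _ /exists_inP[d dT dsub]] := and4P fl.
  rewrite (flip_ofE tT dT fl dsub); apply: imset_f.
  by rewrite !inE dT /= orNb.
have cC : #|phi @: C| <= 1.
  apply: leq_trans (leq_imset_card _ _) _; apply/card_le1_eqP => d e.
  by rewrite !inE => /andP[dT sd] /andP[eT se]; apply: self_similar_unique tT _ _ _ _.
have cD : #|phi @: D| * (n %/ m) <= n - 3.
  apply: (@leq_trans #|D|); last first.
    rewrite -cT; apply/subset_leq_card/subsetP => d; by rewrite inE => /andP[].
  rewrite -[#|D|]sum1_card (partition_big_imset phi) /= -sum_nat_const.
  apply: leq_sum => _ /imsetP[d + ->]; rewrite inE => /andP[dT nsd].
  rewrite sum1_card; apply: leq_trans (orbit_in_fibre tT dT nsd) _.
  apply/subset_leq_card/subsetP => e; rewrite !inE => /and3P[eT nse E].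
  by rewrite unfold_in /= inE eT nse.
have ltD : #|phi @: D| < m.
  rewrite ltnNge; apply/negP => le; have : n <= n - 3.
    by apply: leq_trans cD; rewrite -{1}mk leq_mul2r le orbT.
  by clear -n_gt4; lia.
apply: leq_trans (subset_leq_card sub) _; rewrite cardsU.
by move: cC ltD; clear; lia.
Qed.

Lemma three_triangulations : exists s, [/\ size s = 3, uniq s & all (@triangulation n) s].
Proof.
have tT := fan_triangulation n_gt4; move: (fan _) tT => T tT.
have [_ cT _] := triangulationP _ tT.
have /card_gt1P[d1 [d2 [d1T d2T d12]]] : 1 < #|T| by rewrite cT; clear -n_gt4; lia.
have [fl1 sub1] := flip_ofP tT d1T; have [fl2 sub2] := flip_ofP tT d2T.
exists [:: T; flip_of T d1; flip_of T d2].
have [_ t1 n1 _] := and4P fl1; have [_ t2 n2 _] := and4P fl2.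
rewrite /= tT t1 t2 !inE negb_or (eq_sym T) n1 (eq_sym T) n2 /= andbT; split=> //.
apply: contraNneq n1 => E; rewrite eq_sym eqEcard.
have [_ -> _] := triangulationP _ t1; rewrite cT leqnn andbT; apply/subsetP => d dT.
have [dd|nd] := eqVneq d d1; last by apply: (subsetP sub1); apply/setD1P.
by rewrite E; apply: (subsetP sub2); rewrite dd; apply/setD1P.
Qed.

Theorem kneser_triangulation_hamiltonian : exists s, [/\ 2 < size s, s =i @triangulation n
    & ucycle (@kneser_adj {set 'I_n}) s].
Proof.
have [s3 [sz3 u3 t3]] := three_triangulations.
have [s [cyc sE]] : exists s, ucycle (@kneser_adj {set 'I_n}) s /\ s =i @triangulation n.
  apply: (hamiltonian_of_orbits (g := @flips n) (r := @rotT n)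
    _ _ _ _ _ _ _ _ _ _ _ (fan_triangulation n_gt4)).
  - by move=> A B; apply: disjoint_sym.
  - exact: rotT_inj.
  - exact: disjoint_rotT.
  - by move=> A B; apply: rotT_disjoint.
  - exact: triangulation_rotT.
  - exact: flips_sym.
  - exact: flips_rotT.
  - by move=> A B /and4P[].
  - exact: flips_connected.
  - exact: flips_link.
  exact: flips_few.
exists s; split=> //; rewrite -sz3; apply: uniq_leq_size => // T /(allP t3).
by rewrite sE.
Qed.
End Few.

(** * Crossing diagonals of a convex polygon *)

Section ConvexPosition.

Import Order.TTheory GRing.Theory Num.Theory.
Local Open Scope ring_scope.

Variables (R : realFieldType) (n : nat) (p : 'I_n -> 'rV[R]_2).

Implicit Types (a b c d : 'rV[R]_2) (i j k l : 'I_n).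

Lemma orient_rot a b c : orient a b c = orient b c a.
Proof. rewrite /orient; ring. Qed.

Lemma orient_swap a b c : orient a c b = - orient a b c.
Proof. rewrite /orient; ring. Qed.

Lemma orient_affine a b c d (t : R) :
  orient a b ((1 - t) *: c + t *: d) = (1 - t) * orient a b c + t * orient a b d.
Proof. rewrite /orient !mxE; ring. Qed.

Lemma orient_left a b : orient a b a = 0.
Proof. rewrite /orient; ring. Qed.

Lemma orient_right a b : orient a b b = 0.
Proof. rewrite /orient; ring. Qed.

(** The Pluecker relation for the vectors from [o] to the four other points. *)
Lemma orient_plucker o a b c d :
  orient o a c * orient o b d
    = orient o a b * orient o c d + orient o a d * orient o b c.
Proof. rewrite /orient; ring. Qed.

Lemma row2P a b : a 0 0 = b 0 0 -> a 0 1 = b 0 1 -> a = b.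
Proof.
move=> h0 h1; apply/rowP => -[[|[|//]] h].
  by rewrite (_ : Ordinal h = 0) //; apply/val_inj.
by rewrite (_ : Ordinal h = 1) //; apply/val_inj.
Qed.

Lemma pmul_trans (x y z : R) : 0 < x * y -> 0 < y * z -> 0 < x * z.
Proof.
move=> xy yz; have y2 : 0 < y ^+ 2.
  by rewrite exprn_even_gt0 //=; apply: contraTneq xy => ->; rewrite mulr0 ltxx.
rewrite -(pmulr_rgt0 _ y2); have -> : y ^+ 2 * (x * z) = (x * y) * (y * z) by ring.
exact: mulr_gt0.
Qed.

Hypothesis n_gt2 : (2 < n)%N.
Hypothesis convex : convex_polygon p.

Let o := Ordinal (ltnW (ltnW n_gt2)).

(** Only the sign matters: it tells whether the vertices are listed clockwise or
    counterclockwise. *)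
Definition side : R := orient (p o) (p (ordS o)) (p (ordS (ordS o))).

Lemma ordS2_notin i : ordS (ordS i) \notin [set i; ordS i].
Proof.
have := ordSP i; have := ordSP (ordS i); have := ltn_ord i.
by rewrite !inE !eq_ordE; clear -n_gt2; lia.
Qed.

Lemma notin_next_edge i : i \notin [set ordS i; ordS (ordS i)].
Proof.
have := ordSP i; have := ordSP (ordS i); have := ltn_ord i.
by rewrite !inE !eq_ordE; clear -n_gt2; lia.
Qed.

(** The sign passes from each edge to the next one: the two edges bound the
    triangle of three consecutive vertices, whose orientation decides the side of
    both. *)
Lemma side_edge i k : k \notin [set i; ordS i] ->
  0 < side * orient (p i) (p (ordS i)) (p k).
Proof.
have step j l : 0 < side * orient (p j) (p (ordS j)) (p (ordS (ordS j))) ->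
    l \notin [set j; ordS j] -> 0 < side * orient (p j) (p (ordS j)) (p l).
  move=> pos jl; apply: pmul_trans pos _; exact: convex (ordS2_notin j) jl.
have all m : (m < n)%N -> 0 < side * orient (p (iter m (@ordS n) o))
    (p (ordS (iter m (@ordS n) o))) (p (ordS (ordS (iter m (@ordS n) o)))).
  elim: m => [|m IHm] mn /=; first exact: convex (ordS2_notin o) (ordS2_notin o).
  move: (iter m _ _) (IHm (ltnW mn)) => j pos; apply: pmul_trans pos _.
  by rewrite [X in X * _]orient_rot; apply: convex (notin_next_edge j) (ordS2_notin _).
have -> : i = iter i (@ordS n) o.
  by apply: val_inj; rewrite /= ordS_iter /= add0n modn_small.
apply: step; exact: all.
Qed.

Definition turn i j k := side * orient (p i) (p j) (p k).

(** Induction on [k].  As seen from [i], all later vertices are on one side of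
    the ray towards [i + 1], where turning the same way is transitive by the
    Pluecker relation; this links [j] to [k] through [k - 1]. *)
Lemma turn_lt i j k : (i < j < k)%N -> 0 < turn i j k.
Proof.
move=> /andP[ij]; have [m] := ubnP (k - j)%N; elim: m k => // m IHm k ltm jk.
have hk := ltn_ord k.
have edgeO (x y z : 'I_n) : y = x.+1 :> nat -> z != x -> z != y -> 0 < turn x y z.
  move=> yx zx zy; have yE : y = ordS x.
    by apply: ord_inj; have := ordSP x; have := ltn_ord y; rewrite yx; clear; lia.
  by rewrite /turn yE; apply: side_edge; rewrite !inE negb_or zx -yE.
have ij1 : (i.+1 < n)%N by clear -hk ij jk; lia.
pose u := Ordinal ij1.
have uO (z : 'I_n) : (u < z)%N -> 0 < turn i u z.
  by move=> uz; apply: edgeO => //; rewrite eq_ordE; move: uz => /=; clear; lia.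
have [uj|uj] := eqVneq u j.
  by rewrite -uj; apply: uO; rewrite uj.
have uj' : (u < j)%N by move: uj; rewrite eq_ordE /=; clear -ij; lia.
have kn : (k.-1 < n)%N by clear -hk; lia.
pose k' := Ordinal kn.
have kk' : k = k'.+1 :> nat by rewrite /=; clear -jk; lia.
have ik' : 0 < turn i k' k.
  by rewrite /turn orient_rot; apply: edgeO => //; rewrite eq_ordE; clear -ij jk kk'; lia.
have [jk'|jk'] := eqVneq j k'; first by rewrite jk'.
have ltjk' : (j < k')%N by move: jk'; rewrite eq_ordE; clear -kk' jk; lia.
have Ojk' : 0 < turn i j k' by apply: IHm => //; clear -ltm kk' jk ltjk'; lia.
have Ouj := uO _ uj'.
have Ouk' : 0 < turn i u k' by apply: uO; exact: ltn_trans ltjk'.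
have Ouk : 0 < turn i u k by apply: uO; exact: ltn_trans jk.
rewrite -(pmulr_rgt0 _ Ouk').
have -> : turn i u k' * turn i j k = turn i u j * turn i k' k + turn i u k * turn i j k'.
  have H := orient_plucker (p i) (p u) (p j) (p k') (p k).
  by rewrite /turn [LHS]mulrACA H mulrDr; congr (_ + _); rewrite mulrACA.
by apply: addr_gt0; apply: mulr_gt0.
Qed.

Lemma turn_cyc i j k : cyc i j k -> 0 < turn i j k.
Proof.
rewrite /cyc => /or3P[] h; first exact: turn_lt.
  by rewrite /turn orient_rot -/(turn j k i); apply: turn_lt.
by rewrite /turn -orient_rot -/(turn k i j); apply: turn_lt.
Qed.

Lemma turn_acyc i j k : cyc i k j -> turn i j k < 0.
Proof. by move=> /turn_cyc; rewrite /turn orient_swap mulrN oppr_gt0. Qed.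

Lemma cross_of_crossing i j k l : crossing i j k l ->
  cross p [set i; j] [set k; l].
Proof.
suff main i' j' k' l' : cyc i' k' j' -> cyc j' l' i' ->
    cross p [set i'; j'] [set k'; l'].
  case/orP=> /andP[h1 h2]; first exact: main.
  by rewrite [[set k; l]]setUC; apply: main.
move=> {i j k l} ikj jli.
have kil : cyc k' l' i' by move: ikj jli; rewrite /cyc; clear; lia.
have klj : cyc k' j' l' by move: ikj jli; rewrite /cyc; clear; lia.
(* The intersection point by Cramer's rule.  Both segments have the same
   denominator up to sign. *)
pose A := turn k' l' i'; pose B := turn k' l' j'; pose C := turn i' j' k'; pose D := turn i' j' l'.
have A0 : 0 < A := turn_cyc kil.
have B0 : B < 0 := turn_acyc klj.
have C0 : C < 0 := turn_acyc ikj.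
have D0 : 0 < D by apply: turn_cyc; move: jli; rewrite /cyc; clear; lia.
pose t := A / (A - B); pose u := - C / (A - B).
have CD : D - C = A - B by rewrite /A /B /C /D /turn /orient; ring.
have AB : 0 < A - B by lra.
have t01 : 0 < t < 1 by rewrite /t divr_gt0 //= ltr_pdivrMr //; lra.
have u01 : 0 < u < 1 by rewrite /u divr_gt0 ?ltr_pdivrMr //; lra.
exists ((1 - t) *: p i' + t *: p j'); split; first by exists i', j', t.
exists k', l', u; split=> //.
have AB0 : A - B != 0 by rewrite gt_eqF.
have eq_coord (x y z v : R) :
    (A - B) * x + A * (y - x) = (A - B) * z - C * (v - z) ->
    (1 - t) * x + t * y = (1 - u) * z + u * v.
  move=> E; rewrite /t /u.
  transitivity (((A - B) * x + A * (y - x)) / (A - B)); first by field.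
  by rewrite E; field.
by apply: row2P; rewrite !mxE; apply: eq_coord; rewrite /A /B /C /turn /orient; ring.
Qed.

(** The signed area that the common point forms with p i and p j is zero, and it
    is a proper convex combination of the areas for k and l.  These cannot both
    vanish unless k and l are i or j, nor have opposite signs unless the segments
    interleave. *)
Lemma interior_on_line i j k l (t u : R) : i != j ->
  0 < u < 1 -> (1 - t) *: p i + t *: p j = (1 - u) *: p k + u *: p l ->
  ~~ crossing i j k l -> (k \in [set i; j]) && (l \in [set i; j]).
Proof.
move=> ij /andP[u0 u1] E nx.
have L : (1 - u) * turn i j k + u * turn i j l = 0.
  rewrite /turn !(mulrCA _ side) -mulrDr -orient_affine -E orient_affine.
  by rewrite orient_left orient_right !mulr0 addr0 mulr0.
have pos m : [\/ m \in [set i; j] /\ turn i j m = 0, cyc i j m /\ 0 < turn i j m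
                | cyc i m j /\ turn i j m < 0].
  have [->|mi] := eqVneq m i.
    by apply: Or31; rewrite set21 /turn orient_left mulr0.
  have [->|mj] := eqVneq m j.
    by apply: Or31; rewrite set22 /turn orient_right mulr0.
  have : cyc i j m || cyc i m j.
    by move: mi mj ij; rewrite !eq_ordE /cyc; clear; lia.
  case/orP => h; [apply: Or32 | apply: Or33]; rewrite h; split=> //.
    exact: turn_cyc.
  exact: turn_acyc.
have v0 : 0 < 1 - u by lra.
have gt0 (x y : R) : 0 < x -> 0 < y -> 0 < x * y by exact: mulr_gt0.
have lt0 (x y : R) : 0 < x -> y < 0 -> x * y < 0 by move=> x0; rewrite pmulr_rlt0.
have opp x y : cyc i j x -> cyc i y j -> ~~ crossing i j x y /\ ~~ crossing i j y x -> False.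
  by rewrite /crossing /cyc; clear; lia.
have nx' : ~~ crossing i j l k by move: nx; rewrite /crossing orbC.
case: (pos k) (pos l) => [[ki Ok]|[ck Ok]|[ck Ok]] [[li Ol]|[cl Ol]|[cl Ol]].
- by rewrite ki li.
- by have := gt0 _ _ u0 Ol; move: L; rewrite Ok; lra.
- by have := lt0 _ _ u0 Ol; move: L; rewrite Ok; lra.
- by have := gt0 _ _ v0 Ok; move: L; rewrite Ol; lra.
- by have := gt0 _ _ u0 Ol; have := gt0 _ _ v0 Ok; move: L; lra.
- by case: (opp k l).
- by have := lt0 _ _ v0 Ok; move: L; rewrite Ol; lra.
- by case: (opp l k).
by have := lt0 _ _ u0 Ol; have := lt0 _ _ v0 Ok; move: L; lra.
Qed.

Lemma cross_crosses (d e : {set 'I_n}) : is_diagonal d -> is_diagonal e ->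
  d != e -> cross p d e <-> crosses d e.
Proof.
move=> dd de ne; split.
  case=> x [[i [j [t [dE t01 xE]]]] [k [l [u [eE u01 xE']]]]].
  have ij : i != j by move: dd; rewrite dE is_diagonal2; apply: apart_neq.
  have kl : k != l by move: de; rewrite eE is_diagonal2; apply: apart_neq.
  rewrite dE eE crosses2; apply: contraT => nx.
  have /andP[kij lij] := interior_on_line ij u01 (etrans (esym xE) xE') nx.
  case/eqP: ne; apply/esym/eqP; rewrite eqEcard dE eE !cards2 ij kl andbT.
  by apply/subsetP => m; rewrite !inE => /orP[]/eqP->; rewrite -in_set2.
have [i [j [-> _]]] := is_diagonalP dd; have [k [l [-> _]]] := is_diagonalP de.
by rewrite crosses2; apply: cross_of_crossing.
Qed.

Lemma is_triangulationE T : is_triangulation p T <-> triangulation T.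
Proof.
split=> [[D C X]|/triangulationP[D C X]].
  apply/triangulationP; split=> // d e dT eT; have [<-|ne] := eqVneq d e.
    have [i [j [-> _]]] := is_diagonalP (D _ dT).
    by rewrite crosses2 /crossing /cyc; clear; lia.
  by apply/negP => /(cross_crosses (D _ dT) (D _ eT) ne); apply: X.
split=> // d e dT eT ne /(cross_crosses (D _ dT) (D _ eT) ne).
by apply/negP/X.
Qed.

End ConvexPosition.

Theorem theorem1p1 (R : realFieldType) (n : nat) (p : 'I_n -> 'rV[R]_2) :
  5 <= n -> convex_polygon p ->
  exists c : seq {set {set 'I_n}},
    hamiltonian_cycle (is_triangulation p) (@kneser_adj {set 'I_n}) c.
Proof.
move=> n5 convex; have [c [c2 cE cyc_c]] := kneser_triangulation_hamiltonian n5.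
exists c; split=> // T; rewrite cE.
have n2 : 2 < n by apply: leq_trans n5.
exact: (iff_sym (is_triangulationE n2 convex T)).
Qed.
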